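(* Let $d\ge3$ and let $\mathcal D_f$ be an $f$-divergence on the set $\mathcal P$ of Borel probability measures on the unit sphere $\mathcal S^{d-1}\subset\mathbb R^d$. Let $\mathbb P\in\mathcal P_{\mathcal A}$ be rotationally symmetric about $u\in\mathcal S^{d-1}$, and let $\mathcal Q=\{\mathbb Q_{\nu,\kappa}\mid\nu\in\mathcal S^{d-1},\ \kappa\in\mathbb R_{>0}\}\subseteq\mathcal P_{\mathcal A}$ be the von Mises--Fisher family. If $(\nu,\kappa)\mapsto\mathcal D_f(\mathbb P\|\mathbb Q_{\nu,\kappa})$ has a unique minimiser $(\nu^\star,\kappa^\star)$ over $\mathcal S^{d-1}\times\mathbb R_{>0}$, then $$\mathcal A(\mathbb Q_{\nu^\star,\kappa^\star})=\mathcal A(\mathbb P)=\operatorname{span}(u).$$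
   Context: Let $\sigma$ be the uniform probability measure on $\mathcal S^{d-1}$, and $\mathcal P_\sigma\subseteq\mathcal P$ the set of probability measures absolutely continuous with respect to $\sigma$; for $\pi\in\mathcal P_\sigma$ write $f_\pi=d\pi/d\sigma$. **Rotational symmetry.** $\pi\in\mathcal P_\sigma$ is rotationally symmetric about axis direction $w\in\mathcal S^{d-1}$ if there is a measurable $\psi\colon[-1,1]\to\mathbb R_{\ge0}$ with $f_\pi(x)=\psi(w^\top x)$ for $\sigma$-a.e. $x\in\mathcal S^{d-1}$. **Axis statistic.** $\mathcal P_{\mathcal A}\subseteq\mathcal P_\sigma$ is the set of all distributions that are rotationally symmetric about some axis direction and are not equal to $\sigma$. For $\pi\in\mathcal P_{\mathcal A}$, $\mathcal A(\pi):=\operatorname{span}(w)\in\mathbb RP^{d-1}$ (the set of lines through the origin in $\mathbb R^d$), where $w$ is any axis direction about which $\pi$ is rotationally symmetric; this is well defined because for $d\ge3$ any two axis directions of a non-uniform $\pi$ span the same line. **von Mises--Fisher family.** $\mathbb Q_{\nu,\kappa}\in\mathcal P_\sigma$ has density $f_{\mathbb Q_{\nu,\kappa}}(x)=c_d(\kappa)\exp(\kappa\nu^\top x)$ for $\sigma$-a.e. $x$, where $c_d(\kappa)>0$ is the normalising constant. **$f$-divergence.** Let $f\colon\mathbb R_{>0}\to\mathbb R$ be convex with $f(1)=0$, extended by $f(0):=\lim_{t\downarrow0}f(t)$ and $f'(\infty):=\lim_{t\downarrow0}t f(1/t)$ (both possibly $+\infty$). For probability measures $\mathbb P,\mathbb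 Q$ and any $\sigma$-finite measure $\lambda$ dominating both, with densities $p=d\mathbb P/d\lambda$, $q=d\mathbb Q/d\lambda$, $$\mathcal D_f(\mathbb P\|\mathbb Q):=\int_{\{q>0\}}q\,f(p/q)\,d\lambda+f'(\infty)\,\mathbb P(\{q=0\})\in[0,\infty],\qquad 0\cdot\infty:=0.$$ *)

(* Defs.v *)
From HB Require Import structures.
From mathcomp Require Import all_boot all_order all_algebra.
From mathcomp Require Import all_classical all_reals all_analysis.
From mathcomp Require Import measurable_realfun.

Set Implicit Arguments.
Unset Strict Implicit.
Unset Printing Implicit Defensive.

Import Order.TTheory GRing.Theory Num.Theory.
Import numFieldNormedType.Exports.

Local Open Scope classical_set_scope.
Local Open Scope charge_scope.
Local Open Scope ring_scope.

Definition dot (R : realType) (d : nat) (x y : 'rV[R]_d) : R :=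
  (x *m y^T) 0 0.

(* [sphere R n] is the unit sphere S^n of R^(n+1): the ambient dimension is
   written n.+1 because the sphere of R^0 is empty, whereas a [measurableType]
   must be inhabited. It carries the topology induced by R^(n+1), and its
   measurable sets are the Borel sets of that topology. *)
Definition sphere_set (R : realType) (n : nat) : set 'rV[R]_n.+1 :=
  [set x | dot x x = 1].
Arguments sphere_set : clear implicits.

Definition sphere (R : realType) (n : nat) : Type :=
  set_type (sphere_set R n).

Definition sphere_val (R : realType) (n : nat) (x : sphere R n) : 'rV[R]_n.+1 :=
  \val x.
Coercion sphere_val : sphere >-> matrix.

Definition sphere_display : measure_display.
Proof. exact: default_measure_display. Qed.

Section sphere_structures.
Context (R : realType) (n : nat).

Lemma sphere_pole_subproof : (delta_mx 0 0 : 'rV[R]_n.+1) \in sphere_set R n.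
Proof.
by rewrite inE /sphere_set /dot /= trmx_delta mul_delta_mx mxE !eqxx.
Qed.

HB.instance Definition _ := Topological.on (sphere R n).
HB.instance Definition _ := isPointed.Build (sphere R n)
  (exist _ (delta_mx 0 0) sphere_pole_subproof).
HB.instance Definition _ := @isMeasurable.Build sphere_display (sphere R n)
  <<s @open (sphere R n) >> (@sigma_algebra0 _ setT _) (@sigma_algebraC _ _)
  (@sigma_algebra_bigcup _ setT _).

End sphere_structures.

Section sphere_measurability.
Context (R : realType) (n : nat).

Lemma sphere_val_continuous : continuous (@sphere_val R n).
Proof. exact: (@initial_continuous (set_type (sphere_set R n)) _ set_val). Qed.

Lemma continuous_sphere_measurable (g : sphere R n -> R) :
  continuous g -> measurable_fun setT g.
Proof.
move=> /continuousP cg; apply: (measurability _ (RGenOpens.measurableE R)).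
move=> _ [_ [a [b ->] <-]]; rewrite setTI; apply: sub_sigma_algebra; apply: cg.
exact: interval_open.
Qed.

Lemma dot_continuous (w : 'rV[R]_n.+1) :
  continuous (fun x : sphere R n => dot w x).
Proof.
have -> : (fun x : sphere R n => dot w x) =
    (fun v : 'rV[R]_n.+1 => \sum_i w 0 i * v 0 i) \o @sphere_val R n.
  apply/funext => x /=; rewrite /dot mxE; apply: eq_bigr => i _.
  by rewrite [in LHS]mxE.
move=> x; apply: continuous_comp; first exact: sphere_val_continuous.
move: (sphere_val x) => v.
apply: (@cvg_big _ _ _ _ _ _ _ (nbhs v) _
  (fun i (z : 'rV[R]_n.+1) => w 0 i * z 0 i)).
- exact: add_continuous.
- by move=> i _; apply: cvgM; [exact: cvg_cst|exact: coord_continuous].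
Qed.

End sphere_measurability.

(* The value of [insubd] outside the sphere is never used: for an orthogonal
   matrix O the vector x *m O is again a unit vector. *)
Definition rotate (R : realType) (n : nat) (O : 'M[R]_n.+1) (x : sphere R n) :
    sphere R n :=
  insubd (x : set_type (sphere_set R n)) ((x : 'rV[R]_n.+1) *m O).

(* The uniform distribution on the sphere is the unique Borel probability
   measure that is invariant under the orthogonal group. *)
Definition uniform_on_sphere (R : realType) (n : nat)
    (sigma : probability (sphere R n) R) : Prop :=
  forall O : 'M[R]_n.+1, O *m O^T = 1%:M ->
  forall A : set (sphere R n), measurable A ->
    sigma (rotate O @^-1` A) = sigma A.

Section axis.
Context (R : realType) (n : nat).
Variable sigma : probability (sphere R n) R.
Implicit Types (pi : probability (sphere R n) R) (w : sphere R n).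

Definition sphere_density pi : sphere R n -> \bar R :=
  'd (charge_of_finite_measure pi) '/d sigma.

Definition rotationally_symmetric pi w : Prop :=
  exists psi : R -> R,
    [/\ measurable_fun (`[-1, 1] : set R) psi,
        (forall t, t \in `[-1, 1] -> 0 <= psi t) &
        {ae sigma, forall x, sphere_density pi x = (psi (dot w x))%:E}].

(* A measure is a function on all sets, constrained on the measurable ones only,
   hence pi <> sigma is stated on the Borel sets. *)
Definition axial pi : Prop :=
  [/\ pi `<< sigma,
      exists w, rotationally_symmetric pi w &
      ~ (forall A, measurable A -> pi A = sigma A)].

(* The axis statistic is a partial function, defined on the axial distributions
   only: elsewhere its value is 0, which is not a line. *)
Definition axis pi : {vspace 'rV[R]_n.+1} :=
  xget 0%VS [set L | axial pi /\
    exists w, rotationally_symmetric pi w /\ L = <[w : 'rV[R]_n.+1]>%VS].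

End axis.

(* The normalising constant does not depend on nu, because sigma is invariant
   under the orthogonal group. *)
Section von_mises_fisher.
Context (R : realType) (n : nat).
Variables (sigma : probability (sphere R n) R) (nu : sphere R n) (kappa : R).

Definition vMF_const : R :=
  (fine (\int[sigma]_x (expR (kappa * dot nu (sphere_val x)))%:E))^-1.

Definition vMF_density (x : sphere R n) : R :=
  vMF_const * expR (kappa * dot nu x).

Definition vMF (A : set (sphere R n)) : \bar R :=
  (\int[sigma]_(x in A) (vMF_density x)%:E)%E.

Let expdot (x : sphere R n) := expR (kappa * dot nu x).

Let measurable_expdot : measurable_fun setT expdot.
Proof.
apply: continuous_sphere_measurable => x.
apply: (@continuous_comp _ _ _ (fun x : sphere R n => kappa * dot nu x) expR).
  apply: (@cvgM R _ (nbhs x) _ (cst kappa)); first exact: cvg_cst.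
  exact: dot_continuous.
exact: continuous_expR.
Qed.

Let vMF_const_ge0 : 0 <= vMF_const.
Proof.
by rewrite invr_ge0 fine_ge0// integral_ge0// => x _; rewrite lee_fin expR_ge0.
Qed.

Let vMF_density_ge0 x : 0 <= vMF_density x.
Proof. by rewrite mulr_ge0// expR_ge0. Qed.

Let measurable_vMF_density : measurable_fun setT vMF_density.
Proof. exact: measurable_funM. Qed.

Let vMF0 : vMF set0 = 0%E.
Proof. by rewrite /vMF integral_set0. Qed.

Let vMF_ge0 A : (0 <= vMF A)%E.
Proof. by apply: integral_ge0 => x _; rewrite lee_fin. Qed.

Let vMF_sigma_additive : semi_sigma_additive vMF.
Proof.
move=> /= F mF tF mUF; rewrite /vMF; apply: cvg_toP.
  apply: ereal_nondecreasing_is_cvgn => m k mk.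
  apply: lee_sum_nneg_natr => // i _ _; apply: integral_ge0 => /= x _.
  by rewrite lee_fin.
rewrite ge0_integral_bigcup//=.
- by apply/measurable_funTS/measurableT_comp.
- by move=> x _; rewrite lee_fin.
Qed.

HB.instance Definition _ := isMeasure.Build _ _ _ vMF
  vMF0 vMF_ge0 vMF_sigma_additive.

Lemma sphere_coord_le1 (x : sphere R n) i : `|(x : 'rV[R]_n.+1) 0 i| <= 1.
Proof.
have : dot x x = 1 by exact: set_mem (valP x).
rewrite /dot mxE => xx1.
rewrite -(@ler_pXn2r _ 2%N)// ?nnegrE// expr1n -xx1 real_normK ?num_real//.
rewrite (bigD1 i)//= mxE -expr2 lerDl sumr_ge0// => j _.
by rewrite mxE -expr2 sqr_ge0.
Qed.

Lemma dot_le_dim (x y : sphere R n) : `|dot x y| <= n.+1%:R.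
Proof.
rewrite /dot mxE (le_trans (ler_norm_sum _ _ _))//.
rewrite -[leRHS](_ : \sum_(i < n.+1) (1 : R) = _); last first.
  by rewrite sumr_const card_ord.
apply: ler_sum => i _; rewrite mxE normrM mulr_ile1// sphere_coord_le1//.
Qed.

Let integral_expdot_lty : (\int[sigma]_x (expdot x)%:E < +oo)%E.
Proof.
apply: (@le_lt_trans _ _ (\int[sigma]_x (expR (`|kappa| * n.+1%:R))%:E)%E).
  apply: ge0_le_integral => //.
  - by move=> x _; rewrite lee_fin expR_ge0.
  - exact/measurable_EFinP.
  - move=> x _; rewrite lee_fin ler_expR (le_trans (ler_norm _))// normrM.
    by rewrite ler_wpM2l// dot_le_dim.
rewrite integral_cst; last exact: measurableT.
by rewrite /= probability_setT mule1 ltry.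
Qed.

Let integral_expdot_gt0 : (0 < \int[sigma]_x (expdot x)%:E)%E.
Proof.
apply: (@lt_le_trans _ _ (\int[sigma]_x (expR (- (`|kappa| * n.+1%:R)))%:E)%E).
  rewrite integral_cst; last exact: measurableT.
  by rewrite /= probability_setT mule1 lte_fin expR_gt0.
apply: ge0_le_integral => //.
- exact/measurable_EFinP.
- move=> x _; rewrite lee_fin ler_expR lerNl (le_trans (ler_norm _))//.
  by rewrite normrN normrM ler_wpM2l// dot_le_dim.
Qed.

Let vMF_setT : vMF setT = 1%E.
Proof.
rewrite /vMF; under eq_integral do rewrite EFinM.
rewrite ge0_integralZl//; last exact/measurable_EFinP.
have ifin : (\int[sigma]_x (expdot x)%:E)%E \is a fin_num.
  by rewrite ge0_fin_numE// ltW.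
rewrite -(fineK ifin) -EFinM /vMF_const mulVf// gt_eqF//.
by rewrite fine_gt0// integral_expdot_gt0.
Qed.

HB.instance Definition _ :=
  Measure_isProbability.Build _ _ R vMF vMF_setT.

End von_mises_fisher.

Section measure_add_finite.
Context d (T : measurableType d) (R : realType).
Variables P Q : {finite_measure set T -> \bar R}.

Definition finite_measure_add : set T -> \bar R := measure_add P Q.

HB.instance Definition _ := Measure.on finite_measure_add.

Let finite_measure_add_fin : fin_num_fun finite_measure_add.
Proof.
move=> A mA; rewrite /finite_measure_add measure_addE fin_numD.
by rewrite !fin_num_measure.
Qed.

HB.instance Definition _ :=
  @Measure_isFinite.Build _ T R finite_measure_add finite_measure_add_fin.

End measure_add_finite.

Section f_divergence.
Context (R : realType).
Variable f : R -> R.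

(* Only the values of f on the positive reals are meaningful. *)
Definition fdiv_generator : Prop :=
  convex_function (E := R^o) [set t : R | 0 < t] f /\ f 1 = 0.

Definition fdiv_at0 : \bar R := lim ((f t)%:E @[t --> (0 : R)^'+]).

Definition fdiv_slope : \bar R := lim ((t * f t^-1)%:E @[t --> (0 : R)^'+]).

Definition fdiv_ext (t : R) : \bar R := if t == 0 then fdiv_at0 else (f t)%:E.

Context d (T : measurableType d).

Definition fdiv_wrt (la : {sigma_finite_measure set T -> \bar R})
    (P Q : probability T R) : \bar R :=
  let p x := fine (('d (charge_of_finite_measure P) '/d la) x) in
  let q x := fine (('d (charge_of_finite_measure Q) '/d la) x) in
  (\int[la]_(x in [set x | (0 < q x)%R]) ((q x)%:E * fdiv_ext (p x / q x))
   + fdiv_slope * P [set x | q x = 0%R])%E.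

(* The value of [fdiv_wrt] is the same for all sigma-finite measures dominating
   both P and Q; P + Q is one that always exists. *)
Definition fdiv (P Q : probability T R) : \bar R :=
  fdiv_wrt (finite_measure_add P Q) P Q.

End f_divergence.

Definition unique_minimiser (R : realType) (X : Type) (D : set X)
    (F : X -> \bar R) (m : X) : Prop :=
  let minimiser y := D y /\ forall x, D x -> (F y <= F x)%E in
  minimiser m /\ forall y, minimiser y -> y = m.

(* Main.v *)
From HB Require Import structures.
Require Import Defs.
From mathcomp Require Import all_boot all_order all_algebra.
From mathcomp Require Import finmap ring lra.
From mathcomp Require Import all_classical all_reals all_analysis.
From mathcomp Require Import measurable_realfun.

Import Order.TTheory GRing.Theory Num.Theory.
Import numFieldNormedType.Exports.

Local Open Scope classical_set_scope.
Local Open Scope ring_scope.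

(* Let O be the half-turn x |-> 2 <x, u> u - x about the axis u of P.  It leaves
   P invariant and sends vMF(nu, kappa) to vMF(O nu, kappa), hence it preserves
   the objective, and by uniqueness it fixes nu*: thus nu* lies on the line
   spanned by u.

   It remains to see that the axis of a non-uniform P << sigma is unique.  If P
   has two axes u, w on distinct lines, the measure P(C_t(y)) of the spherical
   cap of centre y depends only on <u, y>, and only on <w, y>.  As d >= 3, this
   forces it to be independent of y.  By Tonelli's theorem on the pairs (x, y)
   with <x, y> > t, two probabilities that give the same measure to all caps of
   the same size agree on the open sets, hence P = sigma. *)

(** * Inner product, reflections and the sphere *)

Section dot_theory.
Context {R : realType} {d : nat}.
Implicit Types (x y z : 'rV[R]_d) (a : R).

Lemma dotE x y : dot x y = \sum_i x 0 i * y 0 i.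
Proof. by rewrite /dot mxE; apply: eq_bigr => i _; rewrite mxE. Qed.

Lemma dotC x y : dot x y = dot y x.
Proof. by rewrite !dotE; apply: eq_bigr => i _; rewrite mulrC. Qed.

Lemma dotDl x y z : dot (x + y) z = dot x z + dot y z.
Proof. by rewrite /dot mulmxDl mxE. Qed.

Lemma dotZl a x y : dot (a *: x) y = a * dot x y.
Proof. by rewrite /dot -scalemxAl mxE. Qed.

Lemma dotNl x y : dot (- x) y = - dot x y.
Proof. by rewrite -scaleN1r dotZl mulN1r. Qed.

Lemma dotBl x y z : dot (x - y) z = dot x z - dot y z.
Proof. by rewrite dotDl dotNl. Qed.

Lemma dotDr x y z : dot x (y + z) = dot x y + dot x z.
Proof. by rewrite !(dotC x) dotDl. Qed.

Lemma dotZr a x y : dot x (a *: y) = a * dot x y.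
Proof. by rewrite !(dotC x) dotZl. Qed.

Lemma dotNr x y : dot x (- y) = - dot x y.
Proof. by rewrite !(dotC x) dotNl. Qed.

Lemma dotBr x y z : dot x (y - z) = dot x y - dot x z.
Proof. by rewrite dotDr dotNr. Qed.

Definition dot_lin := (dotDl, dotBl, dotZl, dotNl, dotDr, dotBr, dotZr, dotNr).

Lemma dot_mulmx x y (O : 'M[R]_d) : dot (x *m O) y = dot x (y *m O^T).
Proof. by rewrite /dot trmx_mul trmxK mulmxA. Qed.

Lemma dot_ge0 x : 0 <= dot x x.
Proof. by rewrite dotE sumr_ge0// => i _; rewrite -expr2 sqr_ge0. Qed.

Lemma dot_eq0 x : (dot x x == 0) = (x == 0).
Proof.
apply/idP/eqP => [|->]; last by rewrite dotE big1// => i _; rewrite mxE mul0r.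
rewrite dotE psumr_eq0 => [/allP/= x0|i _]; last by rewrite -expr2 sqr_ge0.
apply/rowP => i; have := x0 i; rewrite mem_index_enum => /(_ isT).
by rewrite mulf_eq0 orbb mxE => /eqP.
Qed.

(** Row vectors carry the maximum norm; this bound compares it with the Euclidean one. *)
Lemma sqr_coord_le_dot x i : x 0 i ^+ 2 <= dot x x.
Proof.
rewrite dotE (bigD1 i)//= -expr2 lerDl sumr_ge0// => j _.
by rewrite -expr2 sqr_ge0.
Qed.

(** The reflection in the hyperplane orthogonal to [x], acting on rows from the right. As division
    by zero yields zero, it is the identity when [x = 0]. *)
Definition householder x : 'M[R]_d := 1%:M - (2 / dot x x) *: (x^T *m x).

Lemma mulmx_householder y x :
  y *m householder x = y - (2 * dot y x / dot x x) *: x.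
Proof.
rewrite mulmxBr mulmx1 -scalemxAr mulmxA (mx11_scalar (y *m x^T)).
by rewrite mul_scalar_mx scalerA; congr (_ - _ *: _); rewrite -/(dot y x); ring.
Qed.

Definition sym_involution (O : 'M[R]_d) := O^T = O /\ O *m O = 1%:M.

Lemma sym_involutionN O : sym_involution O -> sym_involution (- O).
Proof.
by move=> [OT OO]; split; [rewrite linearN/= OT|rewrite mulNmx mulmxN opprK].
Qed.

Lemma vline_scale a x : a != 0 -> <[a *: x]>%VS = <[x]>%VS.
Proof.
move=> a0; apply/eqP; rewrite eqEsubv -!memvE memvZ ?memv_line//=.
by rewrite -{1}[x](scalerK a0) memvZ ?memv_line.
Qed.

Lemma householder_involution x : sym_involution (householder x).
Proof.
split; first by rewrite linearB/= linearZ/= trmx1 trmx_mul trmxK.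
apply/row_matrixP => i; rewrite 2!rowE mulmxA mulmx1.
move: (delta_mx 0 i) => y; rewrite !mulmx_householder !dot_lin.
have [->|x0] := eqVneq x 0; first by rewrite !scaler0 !subr0.
rewrite -addrA -opprD -scalerDl [X in X *: x](_ : _ = 0) ?scale0r ?subr0//.
by field; rewrite dot_eq0.
Qed.

Lemma dot_involution O x y : sym_involution O ->
  dot (x *m O) (y *m O) = dot x y.
Proof. by move=> [OT OO]; rewrite dot_mulmx OT -mulmxA OO mulmx1. Qed.

End dot_theory.

Section sphere_theory.
Context {R : realType} {n : nat}.
Implicit Types (x y z w u : sphere R n) (O : 'M[R]_n.+1).

Lemma dot_sphere x : dot x x = 1.
Proof. exact: set_mem (valP x). Qed.

Lemma sphere_inj x y : (sphere_val x) = y -> x = y.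
Proof. by move=> xy; apply: val_inj. Qed.

Lemma sphere_exists (v : 'rV[R]_n.+1) : dot v v = 1 ->
  exists x : sphere R n, (sphere_val x) = v.
Proof. by move=> v1; exists (exist _ v (mem_set v1)). Qed.

Lemma dist_sphere x y :
  dot (sphere_val x - sphere_val y) (sphere_val x - sphere_val y)
  = 2 * (1 - dot x y).
Proof. by rewrite !dot_lin !dot_sphere (dotC y x); ring. Qed.

Lemma dot_sphere_le1 x y : dot x y <= 1.
Proof.
by have := dot_ge0 (sphere_val x - sphere_val y); rewrite dist_sphere; lra.
Qed.

Lemma dot_sphere_geN1 x y : -1 <= dot x y.
Proof.
have := dot_ge0 (sphere_val x + sphere_val y).
by rewrite !dot_lin !dot_sphere (dotC y x); lra.
Qed.

Lemma norm_dot_sphere_le1 x y : `|dot x y| <= 1.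
Proof. by rewrite ler_norml dot_sphere_le1 dot_sphere_geN1. Qed.

Lemma dot_sphere_eq1 x y : dot x y = 1 -> x = y.
Proof.
move=> xy; apply/sphere_inj/eqP; rewrite -subr_eq0 -dot_eq0 dist_sphere xy.
by rewrite subrr mulr0.
Qed.

Lemma dot_sphere_eqN1 x y : dot x y = -1 -> (sphere_val x) = - sphere_val y.
Proof.
move=> xy; apply/eqP; rewrite -addr_eq0 -dot_eq0.
by rewrite !dot_lin !dot_sphere (dotC y x) xy; apply/eqP; ring.
Qed.

Lemma rotateE O x : sym_involution O ->
  (rotate O x : 'rV[R]_n.+1) = (sphere_val x) *m O.
Proof.
move=> sO; rewrite /rotate /sphere_val val_insubd ifT// inE /sphere_set/=.
by rewrite dot_involution// -/(sphere_val x) dot_sphere.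
Qed.

Lemma rotateK O : sym_involution O -> involutive (@rotate R n O).
Proof.
move=> sO x; apply: sphere_inj; rewrite !rotateE// -mulmxA.
by case: sO => _ ->; rewrite mulmx1.
Qed.

Lemma dot_rotate O x y : sym_involution O ->
  dot x (rotate O y) = dot (rotate O x) y.
Proof. by move=> sO; rewrite !rotateE// dot_mulmx (proj1 sO). Qed.

(** The mirror bisects [x] and [y], which have equal norm. For [x = y] the matrix is the
    identity. *)
Lemma rotate_householder x y :
  rotate (householder (sphere_val x - sphere_val y)) x = y.
Proof.
apply: sphere_inj; rewrite rotateE; last exact: householder_involution.
rewrite mulmx_householder; have [->|xy] := eqVneq (sphere_val x) y.
  by rewrite subrr scaler0 subr0.
rewrite [X in X *: _](_ : _ = 1) ?scale1r ?subKr// dist_sphere dotBr dot_sphere.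
apply: mulfV; rewrite -dist_sphere dot_eq0 subr_eq0//.
Qed.

(** Here [w] lies in the mirror. Hence the reflections fixing [w] act transitively on each level set
    of [dot w]. *)
Lemma rotate_householder_fix x y w : dot w x = dot w y ->
  rotate (householder (sphere_val x - sphere_val y)) w = w.
Proof.
move=> wxy; apply: sphere_inj; rewrite rotateE;
  last exact: householder_involution.
by rewrite mulmx_householder dotBr wxy subrr mulr0 mul0r scale0r subr0.
Qed.

Lemma rotate_flip u x :
  (rotate (- householder (sphere_val u)) x : 'rV[R]_n.+1) =
  (2 * dot x u) *: (sphere_val u) - sphere_val x.
Proof.
rewrite rotateE; last exact/sym_involutionN/householder_involution.
by rewrite mulmxN mulmx_householder dot_sphere divr1 opprB.
Qed.

Lemma rotate_flip_axis u : rotate (- householder (sphere_val u)) u = u.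
Proof.
apply: sphere_inj; rewrite rotate_flip dot_sphere mulr1 -[X in _ - X]scale1r.
by rewrite -scalerBl -[2]/(1 + 1) addrK scale1r.
Qed.

(** A fixed point satisfies [x = dot x u *: u], and the coefficient is nonzero because [x] is a unit
    vector. *)
Lemma rotate_flip_fix u x : rotate (- householder (sphere_val u)) x = x ->
  <[x : 'rV[R]_n.+1]>%VS = <[u : 'rV[R]_n.+1]>%VS.
Proof.
move/(congr1 (@sphere_val R n)); rewrite rotate_flip => /eqP.
rewrite subr_eq -mulr2n -(scaler_nat 2 (sphere_val x)) -scalerA => /eqP.
have /scalerI/[apply]/esym xu : (2 : R) != 0 by rewrite pnatr_eq0.
have xu0 : dot x u != 0.
  apply: contra_eq_neq (dot_sphere x) => /= xu0.
  rewrite {1}xu xu0 scale0r dotE big1 1?eq_sym ?oner_eq0// => i _.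
  by rewrite mxE mul0r.
by rewrite xu vline_scale.
Qed.

End sphere_theory.

(** * Functions depending only on the height along each of two axes *)

Section two_axes.
Context {R : realType} {n : nat}.
Implicit Types (x y z w u e : sphere R n).

(** Two rows have rank at most 2, so in dimension at least 3 some nonzero vector is orthogonal to
    both; it is then normalised. *)
Lemma exists_orthogonal (A : 'M[R]_(2, n.+1)) : (3 <= n.+1)%N ->
  exists e, A *m (sphere_val e)^T = 0.
Proof.
move=> n3; have : kermx A^T != 0.
  rewrite kermx_eq0 /row_free neq_ltn -(mxrank_tr A^T) trmxK.
  by rewrite (leq_ltn_trans (rank_leq_row A)).
rewrite -nz_row_eq0 => v0; set v := nz_row _ in v0.
have vA : v *m A^T = 0 by apply/eqP; rewrite -sub_kermx nz_row_sub.
have vv : 0 < dot v v by rewrite lt0r dot_eq0 v0 dot_ge0.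
have [|e ev] := @sphere_exists R n ((Num.sqrt (dot v v))^-1 *: v).
  rewrite dotZl dotZr mulrA -expr2 exprVn sqr_sqrtr ?dot_ge0// mulVf//.
  by rewrite gt_eqF.
exists e; apply: trmx_inj; rewrite trmx_mul trmxK ev -scalemxAl vA.
by rewrite scaler0 trmx0.
Qed.

Lemma orthonormal_combination (p q : 'rV[R]_n.+1) (a : R) :
    dot p p = 1 -> dot q q = 1 -> dot p q = 0 -> `|a| <= 1 ->
  exists x, sphere_val x = a *: p + Num.sqrt (1 - a ^+ 2) *: q.
Proof.
move=> p1 q1 pq a1; apply: sphere_exists.
have a2 : a ^+ 2 <= 1 by rewrite -real_normK ?num_real// expr_le1.
rewrite !dot_lin (dotC q) p1 q1 pq !mulr0 addr0 add0r !mulr1 -!expr2.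
by rewrite sqr_sqrtr ?subr_ge0// subrKC.
Qed.

(* The pair [(dot u x, dot w x)] of a point [x] ranges over a full ellipse, as
   some [e] is orthogonal to [u] and [w].  Moving alternately along the level
   sets of [dot u] and of [dot w] multiplies [dot u x] by [(dot u w)^2], until
   [x] can be moved to the equator [dot w x = 0]. *)
Lemma constant_of_two_axes (T : Type) (F : sphere R n -> T) u w :
    (3 <= n.+1)%N -> `|dot u w| < 1 ->
    (forall x y, dot u x = dot u y -> F x = F y) ->
    (forall x y, dot w x = dot w y -> F x = F y) ->
  forall x y, F x = F y.
Proof.
move=> n3 c1 Fu Fw; set c := dot u w in c1.
have [e /matrixP ue_we] :=
  exists_orthogonal
    (\matrix_(i < 2) if i == 0 then sphere_val u else sphere_val w) n3.
have ue : dot u e = 0.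
  have := ue_we 0 0; rewrite !mxE => <-; rewrite dotE.
  by apply: eq_bigr => j _; rewrite !mxE.
have we : dot w e = 0.
  have := ue_we 1 0; rewrite !mxE => <-; rewrite dotE.
  by apply: eq_bigr => j _; rewrite !mxE.
(* Take [y] on the great circle through [p] and [e], at the height of [x] over [p]; as [q] is
   orthogonal to [e], only the component along [p] contributes to [dot q y]. *)
have step (p q : sphere R n) (r := dot p q) : dot p e = 0 -> dot q e = 0 ->
    (forall x y, dot p x = dot p y -> F x = F y) ->
    forall x, exists2 y, F x = F y & dot q y = r * dot p x.
  move=> pe qe Fp x.
  have [y yE] := orthonormal_combination _ _ _ (dot_sphere p) (dot_sphere e) pe
    (norm_dot_sphere_le1 p x).
  exists y; last by rewrite yE !dot_lin qe mulr0 addr0 (dotC q) mulrC.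
  by apply: Fp; rewrite yE !dot_lin pe mulr0 addr0 dot_sphere mulr1.
have iter x k : exists2 z, F x = F z & dot u z = (c ^+ 2) ^+ k * dot u x.
  elim: k => [|k [z Fz uz]]; first by exists x => //; rewrite expr0 mul1r.
  have [y zy wy] := step u w ue we Fu z.
  have [y' yy' uy'] := step w u we ue Fw y.
  exists y'; first by rewrite Fz zy yy'.
  by rewrite uy' wy uz (dotC w) -/c [_ ^+ k.+1]exprS !mulrA -expr2.
(* [s] is the maximum of [dot u] on the equator [dot w = 0], attained at [v] below, the normalised
   component of [u] orthogonal to [w]. *)
set s := Num.sqrt (1 - c ^+ 2).
have c2 : c ^+ 2 < 1 by rewrite -real_normK ?num_real// expr_lt1.
have s0 : 0 < s by rewrite sqrtr_gt0 subr_gt0.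
have s2 : s ^+ 2 = 1 - c ^+ 2 by rewrite sqr_sqrtr// subr_ge0 ltW.
(* The point [e] lies on the equator [dot w = 0] and serves as common reference. *)
suff Fe x : F x = F e by move=> x y; rewrite !Fe.
have [k ck] : exists k, (c ^+ 2) ^+ k < s.
  have : (fun k => (c ^+ 2) ^+ k) @ \oo --> (0 : R).
    by apply: cvg_expr; rewrite ger0_norm// sqr_ge0.
  move/cvgr0Pnorm_lt => /(_ s s0) [k _ /(_ k (leqnn _))/= ck].
  by exists k; exact: le_lt_trans (ler_norm _) ck.
have [z -> uz] := iter x k.
have uzs : `|dot u z| <= s.
  have ck0 : 0 <= (c ^+ 2) ^+ k by apply: exprn_ge0; exact: sqr_ge0.
  apply: le_trans (ltW ck); rewrite uz normrM (ger0_norm ck0) ler_piMr//.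
  exact: norm_dot_sphere_le1.
pose v := s^-1 *: (sphere_val u - c *: sphere_val w).
have s_neq0 := lt0r_neq0 s0.
have uv : dot u v = s.
  rewrite /v !dot_lin dot_sphere -/c -expr2 -s2 expr2 mulrA mulVf ?mul1r//.
have wv : dot w v = 0 by rewrite /v !dot_lin dot_sphere (dotC w) -/c; ring.
have vv : dot v v = 1.
  rewrite /v !dot_lin !dot_sphere (dotC w) -/c.
  rewrite [LHS](_ : _ = s^-1 ^+ 2 * (1 - c ^+ 2)); last by ring.
  by rewrite -s2 exprVn mulVf// expf_neq0.
have ve : dot v e = 0 by rewrite /v !dot_lin ue we; ring.
clearbody v.
(* By [uzs] the equator has a point [y] at the height of [z] over [u]: a level set of [dot u] joins
   [z] to [y], and one of [dot w] joins [y] to [e]. *)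
have [||||y yE] := orthonormal_combination v e (dot u z / s).
- exact: vv.
- exact: dot_sphere.
- exact: ve.
- by rewrite normrM normfV (gtr0_norm s0) ler_pdivrMr// mul1r.
rewrite (Fu z y); last by rewrite yE !dot_lin uv ue mulr0 addr0 divfK.
by apply: Fw; rewrite yE !dot_lin wv we !mulr0 addr0.
Qed.

End two_axes.

(** * Measures giving the same weight to congruent caps *)

Lemma measurable_preimageT d (X : measurableType d) (T : X -> X) (A : set X) :
  measurable_fun setT T -> measurable A -> measurable (T @^-1` A).
Proof. by move=> mT mA; rewrite -[X in measurable X]setTI; apply: mT. Qed.

Section caps.
Context {R : realType} {n : nat}.
Implicit Types (x y z w u : sphere R n) (t : R).

(** Membership is symmetric in the centre and the point, which the Tonelli argument exploits. *)
Definition cap y t : set (sphere R n) := [set x | t < dot y x].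

Lemma dot_continuous_rV (w : 'rV[R]_n.+1) : continuous (dot w).
Proof.
rewrite (_ : dot w = fun v => \sum_i w 0 i * v 0 i); last exact/funext/dotE.
move=> v; apply: (@cvg_big _ _ _ _ _ _ _ (nbhs v) _
  (fun i (z : 'rV[R]_n.+1) => w 0 i * z 0 i)).
- exact: add_continuous.
- by move=> i _; apply: cvgM; [exact: cvg_cst|exact: coord_continuous].
Qed.

Lemma dot_self_continuous : continuous (fun v : 'rV[R]_n.+1 => dot v v).
Proof.
rewrite (_ : (fun v => _) = fun v : 'rV[R]_n.+1 => \sum_i v 0 i * v 0 i).
  move=> v; apply: (@cvg_big _ _ _ _ _ _ _ (nbhs v) _
    (fun i (z : 'rV[R]_n.+1) => z 0 i * z 0 i)).
  - exact: add_continuous.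
  - by move=> i _; apply: cvgM; exact: coord_continuous.
by apply/funext => v; exact: dotE.
Qed.

Lemma sphere_compact : compact (sphere_set R n).
Proof.
apply: bounded_closed_compact.
  exists 1; split => // M M1 v /= v1; rewrite (le_trans _ (ltW M1))//.
  rewrite /Num.norm/= mx_normrE; apply/bigmax_leP; split=> // -[i j] _ /=.
  rewrite ord1 -(@ler_pXn2r _ 2)// ?nnegrE// real_normK ?num_real// expr1n -v1.
  exact: sqr_coord_le_dot.
have -> : sphere_set R n = (fun v : 'rV_n.+1 => dot v v) @^-1` [set 1] by [].
by apply: closed_comp => [v _|]; [exact: dot_self_continuous|exact: closed_eq].
Qed.

Lemma open_cap y t : open (cap y t).
Proof.
move/continuousP: (@dot_continuous R n y) => /(_ _ (@open_gt _ t)).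
by congr open; apply/seteqP.
Qed.

Lemma measurable_cap y t : measurable (cap y t).
Proof. by apply: sub_sigma_algebra; exact: open_cap. Qed.

(** On the sphere [|x - y|^2 = 2 (1 - dot x y)], so caps are Euclidean balls. *)
Lemma openP_cap (U : set (sphere R n)) :
  open U <-> forall x, U x -> exists2 t, t < 1 & cap x t `<=` U.
Proof.
split=> [[V oV <-] x Vx|UP].
  have : nbhs (sphere_val x) V by exact: open_nbhs_nbhs.
  rewrite nbhs_ballP => -[e /= e0 xeV].
  (* At this height the cap is the Euclidean ball of radius [e], which lies in the ball of the
     maximum norm. *)
  exists (1 - e ^+ 2 / 2); first by rewrite ltrBlDr ltrDl divr_gt0// exprn_gt0.
  move=> y; rewrite /cap/= => xy; apply: xeV; split=> // i j.
  rewrite ord1 /ball/=.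
  have := sqr_coord_le_dot (sphere_val x - sphere_val y) j.
  rewrite dist_sphere !mxE => xyj.
  rewrite -(@ltr_pXn2r _ 2)// ?nnegrE ?ltW// real_normK ?num_real//.
  rewrite (le_lt_trans xyj)//; lra.
rewrite openE => x /UP[t t1 xtU]; rewrite /interior.
apply: (filterS xtU); apply: open_nbhs_nbhs; split; first exact: open_cap.
by rewrite /cap/= dot_sphere.
Qed.

Lemma measurable_rotate O : sym_involution O ->
  measurable_fun setT (@rotate R n O).
Proof.
move=> sO; apply: (@measurability _ _ _ _ _ _ (@open (sphere R n))) => //.
move=> _ [U oU <-]; rewrite setTI; apply: sub_sigma_algebra.
apply/openP_cap => x /= Ux; move/openP_cap : oU => /(_ _ Ux)[t t1 tU].
by exists t => // y xy; apply: tU; rewrite /cap/= dot_rotate// rotateK.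
Qed.

Lemma preimage_rotate_cap O y t : sym_involution O ->
  rotate O @^-1` cap y t = cap (rotate O y) t.
Proof. by move=> sO; apply/seteqP; split => x; rewrite /cap/= dot_rotate. Qed.

(** A sum of products of coordinates is measurable for the product sigma-algebra; continuity speaks
    directly only of the Borel sets of the product topology. *)
Lemma measurable_dot : measurable_fun setT
  (fun z : sphere R n * sphere R n => dot (sphere_val z.1) (sphere_val z.2)).
Proof.
have mcoord j : measurable_fun setT (fun x : sphere R n => sphere_val x 0 j).
  rewrite (_ : (fun x => _) =
      fun x : sphere R n => dot (delta_mx 0 j) (sphere_val x)).
    apply: continuous_sphere_measurable; exact: dot_continuous.
  apply/funext => x; rewrite dotE (bigD1 j)//= mxE !eqxx mul1r.
  rewrite big1 ?addr0// => i ij.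
  by rewrite mxE (negPf ij) andbF mul0r.
under eq_fun do rewrite dotE.
apply: measurable_sum => i; apply: measurable_funM.
  exact: (measurableT_comp (mcoord i) measurable_fst).
exact: (measurableT_comp (mcoord i) measurable_snd).
Qed.

Lemma measurable_close_pairs t :
  measurable [set z : sphere R n * sphere R n | t < dot (sphere_val z.1) z.2].
Proof.
have := measurable_dot measurableT _ (measurable_itv `]t, +oo[).
congr measurable; apply/seteqP; split => z; rewrite /= in_itv/= andbT => //.
by move=> [].
Qed.

Lemma measurable_measure_capI (mu : probability (sphere R n) R) A t :
  measurable A -> measurable_fun setT (fun x => mu (A `&` cap x t)).
Proof.
move=> mA; pose E := (setT `*` A) `&`
  [set z : sphere R n * sphere R n | t < dot z.1 z.2].
have mE : measurable E.
  by apply: measurableI; [exact: measurableX|exact: measurable_close_pairs].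
apply: eq_measurable_fun (measurable_fun_xsection mu mE) => x _ /=.
congr (mu _); apply/seteqP; split => y; rewrite /xsection/E/cap/= inE/=.
  by move=> [[]].
by move=> [].
Qed.

(** Both sides are the product measure of the pairs with [x] in [A], [y] in [B] and [t < dot x y],
    sliced in the two orders. *)
Lemma tonelli_cap (mu nu : probability (sphere R n) R) A B t :
    measurable A -> measurable B ->
  (\int[mu]_(x in A) nu (B `&` cap x t) =
   \int[nu]_(y in B) mu (A `&` cap y t))%E.
Proof.
move=> mA mB.
pose E := (A `*` B) `&` [set z : sphere R n * sphere R n | t < dot z.1 z.2].
have mE : measurable E.
  by apply: measurableI; [exact: measurableX|exact: measurable_close_pairs].
have := indic_fubini_tonelli mu nu mE.
rewrite indic_fubini_tonelli_FE// indic_fubini_tonelli_GE// => h.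
rewrite [RHS]integral_mkcond [LHS]integral_mkcond.
transitivity (\int[mu]_x (nu \o xsection E) x)%E; last rewrite h.
  apply: eq_integral => x _; rewrite patchE /=.
  case: ifPn => [|] xA.
    congr (nu _); apply/seteqP; split => y; rewrite /xsection/E/cap/= ?inE/=.
      by move=> []; split=> //; split=> //; exact: set_mem.
    by move=> [[]].
  rewrite [X in nu X](_ : _ = set0) ?measure0// -subset0 => y.
  by rewrite /xsection/E/= inE/= => -[[Ax]]; move: xA; rewrite mem_set.
apply: eq_integral => y _; rewrite patchE /=.
case: ifPn => [|] yB.
  congr (mu _); apply/seteqP; split => x;
      rewrite /ysection/E/cap/= ?inE/= (dotC (sphere_val y)).
    by move=> [[]].
  by move=> []; split=> //; split=> //; exact: set_mem.
rewrite [X in mu X](_ : _ = set0) ?measure0// -subset0 => x.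
by rewrite /ysection/E/= inE/= => -[[_ By]]; move: yB; rewrite mem_set.
Qed.

End caps.

(** * Uniqueness of the probability that weighs congruent caps equally *)

Section cap_homogeneous.
Context {R : realType} {n : nat}.
Implicit Types (mu nu : probability (sphere R n) R) (x y : sphere R n) (t : R).

Definition cap_homogeneous mu := forall t x y, mu (cap x t) = mu (cap y t).

(** By compactness finitely many caps of height [t] cover the sphere; if one were null, all would
    be, and the total mass would vanish. *)
Lemma cap_gt0 mu y t : cap_homogeneous mu -> t < 1 -> (0 < mu (cap y t))%E.
Proof.
move=> hmu t1; rewrite lt0e measure_ge0 andbT; apply/eqP => cap0.
have : cover_compact (sphere_set R n).
  by rewrite -compact_cover; exact: sphere_compact.
(* Compactness is known for a subset of the ambient space, so caps are extended to open
   half-spaces. *)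
pose C (z : sphere R n) := [set v : 'rV_n.+1 | t < dot (sphere_val z) v].
move=> /(_ _ setT C)[].
- move=> z _; move/continuousP: (dot_continuous_rV (sphere_val z)).
  by move=> /(_ _ (@open_gt _ t)); congr open; apply/seteqP.
- move=> v v1; have [z zv] := @sphere_exists R n v v1; exists z => //=.
  by rewrite /C/= -zv dot_sphere.
move=> D _ /= Dcover.
have : (mu setT <= \sum_(z \in [set` D]) mu (cap z t))%E.
  apply: content_sub_fsum => //.
    by move=> z _; exact: measurable_cap.
  move=> x _; have [z zD zx] := Dcover (sphere_val x) (dot_sphere x).
  by exists z.
rewrite fsbig1; last by move=> z _; rewrite (hmu t z y).
by rewrite probability_setT lee_fin ler10.
Qed.

(** Apply Tonelli to the whole sphere: both integrands are constant. *)
Lemma cap_homogeneous_eq mu nu x t : cap_homogeneous mu -> cap_homogeneous nu ->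
  mu (cap x t) = nu (cap x t).
Proof.
move=> hmu hnu; have := tonelli_cap mu nu _ _ t measurableT measurableT.
under eq_integral do rewrite setTI (hnu t _ x).
under [X in _ = X -> _]eq_integral do rewrite setTI (hmu t _ x).
by rewrite !integral_cst//= !probability_setT !mule1 => ->.
Qed.

(* Compare [mu (V m)] with [nu U], where [V m] collects the centres of the caps
   of height [1 / m.+1] contained in [U], by computing the measure of the pairs
   [(x, y)] in [V m * U] that are close to each other in both orders. *)
Lemma cap_homogeneous_open_le mu nu (U : set (sphere R n)) :
  cap_homogeneous mu -> cap_homogeneous nu -> open U -> (mu U <= nu U)%E.
Proof.
move=> hmu hnu oU; have mU : measurable U by exact: sub_sigma_algebra.
pose r (m : nat) : R := 1 - m.+1%:R^-1.
have r1 m : r m < 1 by rewrite ltrBlDr ltrDl invr_gt0.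
(* By symmetry of caps, [x] is in [V m] exactly when [cap x (r m)] is contained in [U]; as the
   complement of an open set, [V m] is measurable. *)
pose V m : set (sphere R n) := ~` \bigcup_(y in ~` U) cap y (r m).
have VE m x : V m x -> cap x (r m) `<=` U.
  move=> Vx y xy; apply: contrapT => Uy; apply: Vx; exists y => //.
  by rewrite /cap/= dotC.
have mV m : measurable (V m).
  apply: measurableC; apply: sub_sigma_algebra; apply: bigcup_open => y _.
  exact: open_cap.
have VU : \bigcup_m V m = U.
  apply/seteqP; split=> [x [m _ /VE]|x Ux].
    by apply; rewrite /cap/= dot_sphere.
  move/openP_cap : oU => /(_ _ Ux)[t t1 tU].
  have [m tm] : exists m, t < r m.
    have : (fun k => k.+1%:R^-1) @ \oo --> (0 : R) by exact: cvg_harmonic.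
    have d0 : 0 < 1 - t by rewrite subr_gt0.
    move/cvgr0Pnorm_lt => /(_ _ d0)[m _ /(_ m (leqnn _))/=].
    rewrite ger0_norm ?invr_ge0// => mt; by exists m; rewrite ltrBrDl -ltrBrDr.
  exists m => //= -[y Uy yx]; apply: Uy; apply: tU.
  by rewrite /cap/= dotC (lt_trans tm).
have homoV : {homo V : i j / (i <= j)%N >-> (i <= j)%O}.
  move=> i j ij; apply/subsetPset; apply: subsetC => x [y Uy yx].
  exists y => //; apply: le_lt_trans yx; rewrite lerD2l lerN2.
  by rewrite lef_pV2 ?posrE// ler_nat.
have := @nondecreasing_cvg_mu _ _ _ mu V mV.
rewrite VU => /(_ mU homoV) /[dup] cV /cvg_lim <-//.
apply: lime_le; first by apply/cvg_ex; exists (mu U).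
apply: nearW => m /=.
(* [h] is the common measure of the caps of height [r m]. After multiplication by [h], the left side
   is the integral of [nu (U & cap x (r m))] over [V m]; exchanging the order bounds it by
   [h * nu U]. *)
pose h := nu (cap point (r m)).
have h0 : (0 < h)%E by exact: cap_gt0.
have hfin : h \is a fin_num by exact: fin_num_measure (measurable_cap _ _).
rewrite -(lee_pmul2l hfin h0) -!integral_cst//.
rewrite (eq_integral (fun x => nu (U `&` cap x (r m)))); last first.
  move=> x; rewrite inE => /VE xU; rewrite /= /h (hnu _ _ x).
  by congr (nu _); rewrite setIidr.
rewrite tonelli_cap//; apply: ge0_le_integral => //.
- by apply: measurable_funTS; apply: measurable_measure_capI.
- move=> y _; rewrite /= /h -(cap_homogeneous_eq _ _ _ _ hmu hnu) (hmu _ _ y).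
  apply: le_measure; rewrite ?inE//; last exact: measurable_cap.
  by apply: measurableI => //; exact: measurable_cap.
Qed.

(** The inequality on open sets holds in both directions, and the open sets are a generating class
    stable under intersection. *)
Lemma cap_homogeneous_unique mu nu : cap_homogeneous mu -> cap_homogeneous nu ->
  forall A, measurable A -> mu A = nu A.
Proof.
move=> hmu hnu.
apply: (@measure_unique _ _ _ (@open (sphere R n)) (fun=> setT)) => //.
- exact: openI.
- by move=> _; exact: openT.
- by rewrite bigcup_const//; exists 0%N.
- by move=> A oA; apply/eqP; rewrite eq_le !cap_homogeneous_open_le.
- by move=> _; rewrite [ltLHS]probability_setT ltry.
Qed.

End cap_homogeneous.

(** * Invariance of integrals and f-divergences under an involution *)

Import HBNNSimple.

Section transport.
Local Open Scope charge_scope.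
Context {d} {X : measurableType d} {R : realType}.
Local Open Scope ereal_scope.

(** The integral of a nonnegative function is a supremum over simple functions below it, so
    monotonicity requires no measurability. *)
Lemma ge0_le_integralT (mu : {measure set X -> \bar R}) (F G : X -> \bar R) :
  (forall x, 0 <= F x) -> (forall x, F x <= G x) ->
  \int[mu]_x F x <= \int[mu]_x G x.
Proof.
move=> F0 FG; rewrite !ge0_integralTE//; last first.
  by move=> x; exact: le_trans (FG x).
apply: le_ereal_sup => _ [h hF <-]; exists h => // x.
exact: le_trans (hF x) (FG x).
Qed.

Variable T : X -> X.
Hypotheses (mT : measurable_fun setT T) (TK : involutive T).

(** [nu] is the image measure of [mu] under [T]; measures are constrained on measurable sets
    only. *)
Definition transports (mu nu : set X -> \bar R) :=
  forall A, measurable A -> nu A = mu (T @^-1` A).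

Lemma preimage_involutionK A : T @^-1` (T @^-1` A) = A.
Proof. by apply/seteqP; split=> x /=; rewrite TK. Qed.

Lemma transports_sym mu nu : transports mu nu -> transports nu mu.
Proof.
move=> munu A mA; rewrite munu; first by rewrite preimage_involutionK.
exact: measurable_preimageT.
Qed.

Lemma ge0_integral_transports (mu nu : {measure set X -> \bar R}) D F :
    transports mu nu -> measurable D -> measurable_fun D F ->
    (forall x, D x -> 0 <= F x) ->
  \int[nu]_(x in D) F x = \int[mu]_(x in T @^-1` D) F (T x).
Proof.
move=> munu mD mF F0.
pose T' : {mfun X >-> X} := HB.pack T (isMeasurableFun.Build _ _ _ _ T mT).
rewrite -(ge0_integral_pushforward mT)//; last by move=> x; rewrite inE => /F0.
by apply: (eq_measure_integral (pushforward mu T')) => A mA _; rewrite munu.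
Qed.

Lemma integrable_transports (mu nu : {measure set X -> \bar R}) D F :
    transports mu nu -> measurable D -> measurable_fun setT F ->
    mu.-integrable (T @^-1` D) (F \o T) -> nu.-integrable D F.
Proof.
move=> munu mD mF /integrableP[mFT iF]; apply/integrableP; split.
  exact: measurable_funTS.
rewrite (@ge0_integral_transports mu)//; last first.
by apply: measurableT_comp => //; exact: measurable_funTS.
Qed.

Lemma integral_transports (mu nu : {measure set X -> \bar R}) D F :
    transports mu nu -> measurable D -> measurable_fun setT F ->
    mu.-integrable (T @^-1` D) (F \o T) ->
  \int[nu]_(x in D) F x = \int[mu]_(x in T @^-1` D) F (T x).
Proof.
move=> munu mD mF iF.
pose T' : {mfun X >-> X} := HB.pack T (isMeasurableFun.Build _ _ _ _ T mT).
rewrite -(integral_pushforward mT)//.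
by apply: (eq_measure_integral (pushforward mu T')) => A mA _; rewrite munu.
Qed.

Lemma ae_transports (mu nu : {measure set X -> \bar R}) (Q : X -> Prop) :
  transports mu nu -> {ae mu, forall x, Q (T x)} -> {ae nu, forall x, Q x}.
Proof.
move=> munu [N [mN N0 QN]]; exists (T @^-1` N); split.
- exact: measurable_preimageT.
- by rewrite munu ?preimage_involutionK//; exact: measurable_preimageT.
- by move=> x /= Qx; apply: QN => /=; rewrite TK.
Qed.

(* Stated for arbitrary functions because the integrand of an f-divergence need
   not be measurable: f is constrained on the positive reals only, whereas a
   density may take negative values on a null set. *)
Lemma ge0_le_integral_transports (mu nu : {measure set X -> \bar R}) F G :
    transports mu nu -> (forall x, 0 <= F x) -> (forall x, 0 <= G x) ->
    {ae mu, forall x, F x <= G (T x)} ->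
  \int[mu]_x F x <= \int[nu]_x G x.
Proof.
move=> munu F0 G0 [N [mN N0 FGN]]; rewrite ge0_integralTE//.
apply: ge_ereal_sup => _ [h hF <-].
(* Cutting [h] to zero on the null set [N] keeps its integral and makes [k (T x) <= G x] hold
   everywhere. *)
pose k x := (h x * \1_(~` N) x)%R.
have mk : measurable_fun setT k.
  by apply: measurable_funM => //; apply: measurable_indic; exact: measurableC.
have k0 x : (0 <= k x)%R by rewrite mulr_ge0// indicE.
have -> : sintegral mu h = \int[mu]_x (h x)%:E.
  by rewrite integral_nnsfun// patch_setT.
have -> : \int[mu]_x (h x)%:E = \int[mu]_x (k x)%:E.
  apply: ge0_ae_eq_integral => //.
  - by apply/measurable_EFinP; exact: measurable_funP.
  - exact/measurable_EFinP.
  - by move=> x _; rewrite lee_fin.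
  - by move=> x _; rewrite lee_fin.
  exists N; split=> // x /=; apply: contra_notP => Nx _.
  by rewrite /k indicE mem_set//= mulr1.
have -> : \int[mu]_x (k x)%:E = \int[nu]_x (k (T x))%:E.
  rewrite (ge0_integral_transports mu nu _ _ munu)//; last first.
  - by move=> x _; rewrite lee_fin.
  - by apply/measurable_EFinP; exact: measurableT_comp.
  - by rewrite preimage_setT; apply: eq_integral => x _; rewrite TK.
apply: ge0_le_integralT => x; first by rewrite lee_fin.
rewrite /k indicE; case: (boolP (_ \in _)) => [|_]; last by rewrite mulr0.
rewrite inE /= => NTx; rewrite mulr1 (le_trans (hF _))//.
by apply: contra_notP NTx => FG; apply: FGN; rewrite /= TK.
Qed.

(** The hypothesis is symmetric under the involution, so each of the positive and negative parts is
    compared in both directions. *)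
Lemma integral_ae_transports (mu nu : {measure set X -> \bar R}) F G :
    transports mu nu -> {ae mu, forall x, F x = G (T x)} ->
  \int[mu]_x F x = \int[nu]_x G x.
Proof.
move=> munu FG.
have numu := transports_sym _ _ munu.
have GF : {ae nu, forall x, G x = F (T x)}.
  by apply: (ae_transports _ _ _ munu); apply: filterS FG => x /=; rewrite TK.
rewrite [LHS]integralE [RHS]integralE; congr (_ - _); apply/eqP; rewrite eq_le;
  apply/andP; split; apply: ge0_le_integral_transports => //.
- by apply: filterS FG => x /= e; rewrite !funeposE e.
- by apply: filterS GF => x /= e; rewrite !funeposE e.
- by apply: filterS FG => x /= e; rewrite !funenegE e.
- by apply: filterS GF => x /= e; rewrite !funenegE e.
Qed.

Lemma ae_eq_measure (mu : {measure set X -> \bar R}) A B :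
  measurable A -> measurable B -> {ae mu, forall x, A x <-> B x} -> mu A = mu B.
Proof.
wlog suff: A B / measurable A -> measurable B ->
    {ae mu, forall x, A x <-> B x} -> mu A <= mu B.
  move=> le mA mB AB; apply/eqP; rewrite eq_le !le//.
  by apply: filterS AB => x [].
move=> mA mB [N [mN N0 ABN]]; have AN : A `<=` B `|` N.
  move=> x Ax; have [Bx|Bx] := pselect (B x); [by left|right].
  by apply: ABN => /= -[/(_ Ax)].
rewrite (le_trans (le_measure mu _ _ AN)) ?inE//; first exact: measurableU.
by apply: (le_trans (measureU2 mu mB mN)); rewrite [X in _ + X]N0 adde0.
Qed.

Lemma transports_dominates (P P' mu mu' : {finite_measure set X -> \bar R}) :
  P `<< mu -> transports P P' -> transports mu mu' -> P' `<< mu'.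
Proof.
move=> Pmu PP' mumu'.
apply/null_content_dominatesP => A mA muA0; rewrite PP'//.
move/null_content_dominatesP : Pmu; apply; first exact: measurable_preimageT.
by rewrite -muA0; apply/esym/mumu'.
Qed.

(** Densities are determined by their integrals, and the integral of [p' \o T] over [E] is [P'] of
    the preimage of [E], that is [P E]. *)
Lemma Radon_Nikodym_transports
    (P P' mu mu' : {finite_measure set X -> \bar R}) :
    P `<< mu -> transports P P' -> transports mu mu' ->
  {ae mu, forall x, ('d (charge_of_finite_measure P) '/d mu) x =
                    ('d (charge_of_finite_measure P') '/d mu') (T x)}.
Proof.
move=> Pmu PP' mumu'.
have Pmu' := transports_dominates P P' mu mu' Pmu PP' mumu'.
set p' := 'd (charge_of_finite_measure P') '/d mu'.
have ip' : mu'.-integrable setT p' by exact: Radon_Nikodym_integrable.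
have mp' : measurable_fun setT p' by exact: measurable_int ip'.
have mpT : measurable_fun setT (p' \o T) by exact: measurableT_comp.
have ipT : mu.-integrable setT (p' \o T).
  apply: (integrable_transports mu') => //; first exact: transports_sym.
  by rewrite preimage_setT; apply: eq_integrable ip' => // x _ /=; rewrite TK.
suff : ae_eq mu setT ('d (charge_of_finite_measure P) '/d mu) (p' \o T).
  by apply: filterS => x /(_ I).
apply: integral_ae_eq => //; first exact: Radon_Nikodym_integrable.
move=> E _ mE; rewrite -Radon_Nikodym_integral//.
have mTE : measurable (T @^-1` E) by exact: measurable_preimageT.
rewrite -[in RHS](preimage_involutionK E) -(integral_transports mu mu')//.
  rewrite -Radon_Nikodym_integral//; apply/esym.
  by rewrite -{2}(preimage_involutionK E); exact: PP'.
by rewrite preimage_involutionK; exact: integrableS ipT.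
Qed.

(** The reference measure [P + Q] is transported to [P' + Q'], hence densities to densities almost
    everywhere. *)
Lemma fdiv_transports (f : R -> R) (P P' Q Q' : probability X R) :
  transports P P' -> transports Q Q' -> fdiv f P Q = fdiv f P' Q'.
Proof.
move=> PP' QQ'; rewrite /fdiv /fdiv_wrt.
set mu := finite_measure_add P Q; set mu' := finite_measure_add P' Q'.
have mumu' : transports mu mu'.
  move=> A mA; rewrite /mu/mu' /finite_measure_add !measure_addE.
  by congr (_ + _); [exact: PP'|exact: QQ'].
have Pmu : P `<< mu.
  apply/null_content_dominatesP => A mA /eqP.
  rewrite /mu /= /finite_measure_add measure_addE padde_eq0//.
  by move=> /andP[/eqP].
have Qmu : Q `<< mu.
  apply/null_content_dominatesP => A mA /eqP.
  rewrite /mu /= /finite_measure_add measure_addE padde_eq0//.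
  by move=> /andP[_ /eqP].
have pE := Radon_Nikodym_transports P P' mu mu' Pmu PP' mumu'.
have qE := Radon_Nikodym_transports Q Q' mu mu' Qmu QQ' mumu'.
congr (_ + _).
  (* The domain depends on the density, so it is absorbed into the integrand. *)
  rewrite integral_mkcond [RHS]integral_mkcond.
  apply: integral_ae_transports => //.
  apply: filterS2 pE qE => x px qx.
  rewrite !patchE /= px qx; congr (if _ then _ else _).
  by apply/idP/idP => /set_mem /= h; apply/mem_set; rewrite /= qx in h *.
congr (_ * _).
have mq0 (la nu : {finite_measure set X -> \bar R}) : nu `<< la ->
    measurable
      [set x | fine (('d (charge_of_finite_measure nu) '/d la) x) = 0%R].
  move=> nula; rewrite -[X in measurable X]setTI.
  have mq : measurable_fun setT ('d (charge_of_finite_measure nu) '/d la).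
    by apply: (measurable_int la); exact: Radon_Nikodym_integrable.
  have mfq : measurable_fun setT
    (fun x => fine (('d (charge_of_finite_measure nu) '/d la) x)).
    exact: measurableT_comp.
  exact: (mfq measurableT [set 0%R] (measurable_set1 _)).
have Q'mu' : Q' `<< mu' by exact: (transports_dominates Q Q' mu mu').
rewrite [RHS]PP'; last exact: mq0.
(* The two zero sets differ by a [mu]-null set, which is [P]-null because [mu] dominates [P]. *)
apply: ae_eq_measure; first exact: mq0.
  by apply: measurable_preimageT => //; exact: mq0.
have [N [mN N0 qN]] := qE; exists N; split=> //.
  by move/null_content_dominatesP : Pmu; apply.
by apply: subset_trans qN; apply: subsetC => x /= ->.
Qed.

End transport.

(** * Rotationally symmetric distributions *)

Section axial_distributions.
Local Open Scope charge_scope.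
Context {R : realType} {n : nat}.
Variable sigma : probability (sphere R n) R.
Hypothesis hsigma : uniform_on_sphere sigma.
Implicit Types (P : probability (sphere R n) R) (x y z w u nu : sphere R n).

Lemma uniform_transports O : sym_involution O ->
  transports (rotate O) sigma sigma.
Proof. by move=> [OT OO] A mA; rewrite hsigma ?OT. Qed.

Lemma ge0_integral_rotate O D F : sym_involution O -> measurable D ->
    measurable_fun D F -> (forall x, D x -> (0 <= F x)%E) ->
  (\int[sigma]_(x in D) F x =
   \int[sigma]_(x in rotate O @^-1` D) F (rotate O x))%E.
Proof.
move=> sO mD mF F0; apply: (ge0_integral_transports _ _ sigma) => //.
  exact: measurable_rotate.
exact: uniform_transports.
Qed.

(** The density is a function of [dot u x], which [O] preserves as it fixes [u], and [sigma] is
    invariant under [O]. *)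
Lemma rotate_invariant P u O :
  P `<< sigma -> rotationally_symmetric sigma P u ->
  sym_involution O -> rotate O u = u -> transports (rotate O) P P.
Proof.
move=> Psigma [psi [mpsi psi0 dP]] sO Ou.
have mg : measurable_fun setT (fun x => (psi (dot u (sphere_val x)))%:E).
  apply/measurable_EFinP.
  (* [psi] is measurable on [[-1, 1]] only, the range of inner products of unit vectors. *)
  have := @measurable_comp _ _ _ (sphere R n) R R `[-1, 1]%classic psi setT
    (fun x : sphere R n => dot u (sphere_val x)).
  apply => //.
  - by move=> _ [x _ <-] /=; rewrite in_itv/= dot_sphere_le1 dot_sphere_geN1.
  - by apply: continuous_sphere_measurable; exact: dot_continuous.
have PE A : measurable A ->
    P A = (\int[sigma]_(x in A) (psi (dot u (sphere_val x)))%:E)%E.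
  move=> mA; have -> : P A = (\int[sigma]_(x in A) sphere_density sigma P x)%E.
    by rewrite /sphere_density -Radon_Nikodym_integral.
  apply: ae_eq_integral => //; [|exact: measurable_funTS|].
    apply: measurable_funTS; apply: (measurable_int sigma).
    exact: Radon_Nikodym_integrable.
  by apply: filterS dP => x + _.
move=> A mA; rewrite !PE//; last first.
  by apply: measurable_preimageT => //; exact: measurable_rotate.
rewrite (ge0_integral_rotate O _ _ sO mA (measurable_funTS mg)).
  by apply: eq_integral => x _; rewrite dot_rotate// Ou.
move=> x _; rewrite lee_fin psi0// in_itv/=.
by rewrite dot_sphere_le1 dot_sphere_geN1.
Qed.

Lemma uniform_cap_homogeneous : cap_homogeneous sigma.
Proof.
move=> t x y; set O := householder (sphere_val x - sphere_val y).
have sO : sym_involution O by exact: householder_involution.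
rewrite (uniform_transports _ sO (cap x t)); last exact: measurable_cap.
by rewrite preimage_rotate_cap// rotate_householder.
Qed.

(** The reflection exchanging [x] and [y] fixes [u], hence preserves [P] and exchanges the two
    caps. *)
Lemma cap_axial P u x y t : P `<< sigma -> rotationally_symmetric sigma P u ->
  dot u x = dot u y -> P (cap x t) = P (cap y t).
Proof.
move=> Psigma Pu uxy; set O := householder (sphere_val x - sphere_val y).
have sO : sym_involution O by exact: householder_involution.
have PO := rotate_invariant _ _ _ Psigma Pu sO
  (rotate_householder_fix _ _ _ uxy).
rewrite PO; last exact: measurable_cap.
by rewrite preimage_rotate_cap// rotate_householder.
Qed.

(** If [|dot u w| < 1], both axes together make [P] cap-homogeneous, hence equal to [sigma], which
    [axial] excludes. Otherwise [u] is [w] or its antipode. *)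
Lemma axis_unique P u w : (3 <= n.+1)%N -> axial sigma P ->
    rotationally_symmetric sigma P u -> rotationally_symmetric sigma P w ->
  <[sphere_val w]>%VS = <[sphere_val u]>%VS.
Proof.
move=> n3 [Psigma _ Pneq] Pu Pw.
have [uw1|] := ltP `|dot u w| 1.
  exfalso; apply: Pneq; apply: cap_homogeneous_unique.
    move=> t.
    apply: (constant_of_two_axes _ (fun x => P (cap x t)) u w) => // x y.
      exact: cap_axial.
    exact: cap_axial.
  exact: uniform_cap_homogeneous.
rewrite ler_normr => /orP[uw1|uw1].
  rewrite (_ : u = w)//; apply: dot_sphere_eq1; apply/eqP.
  by rewrite eq_le dot_sphere_le1.
rewrite (_ : sphere_val u = -1 *: sphere_val w).
  by rewrite vline_scale// oppr_eq0 oner_eq0.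
rewrite scaleN1r; apply: dot_sphere_eqN1; apply/eqP.
by rewrite eq_le dot_sphere_geN1 andbT lerNr.
Qed.

(** By [axis_unique] the choice made in [axis] is among a single line. *)
Lemma axisE P u : (3 <= n.+1)%N -> axial sigma P ->
  rotationally_symmetric sigma P u -> axis sigma P = <[sphere_val u]>%VS.
Proof.
move=> n3 axP Pu; apply: xget_unique; first by split => //; exists u.
by move=> L [_ [w [Pw ->]]]; exact: (axis_unique P).
Qed.

(** * The von Mises-Fisher distributions *)

Lemma vMF_const_ge0 nu kappa : 0 <= vMF_const sigma nu kappa.
Proof.
rewrite invr_ge0 fine_ge0//; apply: integral_ge0 => x _.
by rewrite lee_fin expR_ge0.
Qed.

Lemma measurable_vMF_density nu kappa :
  measurable_fun setT (vMF_density sigma nu kappa).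
Proof.
apply: measurable_funM => //; apply: measurableT_comp => //.
apply: measurable_funM => //.
by apply: continuous_sphere_measurable; exact: dot_continuous.
Qed.

Lemma vMF_density_ge0 nu kappa x : 0 <= vMF_density sigma nu kappa x.
Proof. by rewrite mulr_ge0 ?expR_ge0// vMF_const_ge0. Qed.

(** Invariance of [sigma] gives equal normalising constants for [nu] and its image, and the
    exponents correspond because [O] is self-adjoint. *)
Lemma vMF_rotate O nu kappa : sym_involution O ->
  transports (rotate O) (vMF sigma nu kappa) (vMF sigma (rotate O nu) kappa).
Proof.
move=> sO A mA; rewrite /vMF.
have mexp w : measurable_fun setT
    (fun x => (expR (kappa * dot (sphere_val w) (sphere_val x)))%:E).
  apply/measurable_EFinP; apply: measurableT_comp => //.
  apply: measurable_funM => //.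
  by apply: continuous_sphere_measurable; exact: dot_continuous.
have cE : vMF_const sigma (rotate O nu) kappa = vMF_const sigma nu kappa.
  rewrite /vMF_const (ge0_integral_rotate O _ _ sO measurableT (mexp nu)).
    under [in RHS]eq_integral do rewrite dot_rotate//.
    by rewrite preimage_setT.
  by move=> x _; rewrite lee_fin expR_ge0.
have mdens : measurable_fun A
    (fun x => (vMF_density sigma (rotate O nu) kappa x)%:E).
  apply: measurable_funTS; apply/measurable_EFinP.
  exact: measurable_vMF_density.
rewrite (ge0_integral_rotate O _ _ sO mA mdens); last first.
  by move=> x _; rewrite lee_fin vMF_density_ge0.
apply: eq_integral => x _; congr (_%:E).
by rewrite /vMF_density cE (dot_rotate O (rotate O nu) x sO) rotateK.
Qed.

Lemma vMF_dominated nu kappa : vMF sigma nu kappa `<< sigma.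
Proof.
apply/null_content_dominatesP => A mA sA0; rewrite /vMF.
apply: null_set_integral => //.
by apply: measurable_funTS; apply/measurable_EFinP;
  exact: measurable_vMF_density.
Qed.

Lemma vMF_rotationally_symmetric nu kappa :
  rotationally_symmetric sigma (vMF sigma nu kappa) nu.
Proof.
exists (fun t => vMF_const sigma nu kappa * expR (kappa * t)); split.
- apply: measurable_funTS; apply: measurable_funM => //.
  by apply: measurableT_comp => //; exact: measurable_funM.
- by move=> t _; rewrite mulr_ge0 ?expR_ge0// vMF_const_ge0.
suff : ae_eq sigma setT (sphere_density sigma (vMF sigma nu kappa))
    (fun x => (vMF_density sigma nu kappa x)%:E).
  by apply: filterS => x /(_ I).
have dom := vMF_dominated nu kappa.
apply: integral_ae_eq => //.
- exact: Radon_Nikodym_integrable.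
- by apply/measurable_EFinP;
  exact: measurable_vMF_density.
by move=> E _ mE; rewrite -Radon_Nikodym_integral.
Qed.

(* The density is at least [c * expR (kappa / 2)] on the cap of height 1/2
   around [nu], and at most [c * expR (- kappa / 2)] on the opposite cap. *)
Lemma vMF_neq_uniform nu kappa : 0 < kappa ->
  ~ (forall A, measurable A -> vMF sigma nu kappa A = sigma A).
Proof.
move=> k0 vMFE; set c := vMF_const sigma nu kappa.
have c0 : 0 <= c by exact: vMF_const_ge0.
have [mu mu_nu] : exists mu : sphere R n, sphere_val mu = - sphere_val nu.
  by apply: sphere_exists; rewrite !dot_lin opprK dot_sphere.
have half1 : 1 / 2 < 1 :> R by lra.
have capP y : [/\ measurable (cap y (1 / 2)), (0 < sigma (cap y (1 / 2)))%E &
    sigma (cap y (1 / 2)) \is a fin_num].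
  split; [exact: measurable_cap| |exact: fin_num_measure (measurable_cap _ _)].
  by apply: cap_gt0 => //; exact: uniform_cap_homogeneous.
have mdens A : measurable_fun A (fun x => (vMF_density sigma nu kappa x)%:E).
  by apply: measurable_funTS; apply/measurable_EFinP;
  exact: measurable_vMF_density.
have [mA sA0 sAfin] := capP nu; have [mB sB0 sBfin] := capP mu.
(* Equality with [sigma] on the two caps would give [c * expR (kappa / 2) <= 1 <= c * expR (- kappa
   / 2)], impossible for positive [c] and [kappa]. *)
have leA : c * expR (kappa * (1 / 2)) <= 1.
  rewrite -lee_fin -(lee_pmul2r sAfin sA0) mul1e -[leRHS]vMFE// /vMF.
  rewrite -integral_cst//; apply: ge0_le_integral => //.
  - by move=> x _; rewrite lee_fin mulr_ge0 ?expR_ge0.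
  - move=> x /= /ltW xA; rewrite lee_fin ler_wpM2l// ler_expR.
    by rewrite ler_wpM2l// ltW.
have leB : 1 <= c * expR (kappa * - (1 / 2)).
  rewrite -lee_fin -(lee_pmul2r sBfin sB0) mul1e -[leLHS]vMFE// /vMF.
  rewrite -integral_cst//; apply: ge0_le_integral => //.
  - by move=> x _; rewrite lee_fin vMF_density_ge0.
  - move=> x /= xB; rewrite lee_fin ler_wpM2l// ler_expR ler_wpM2l// ?ltW//.
    by move: xB; rewrite /cap/= mu_nu dotNl ltrNr.
have := le_trans leA leB; rewrite leNgt => /negP; apply.
have c1 : 0 < c.
  by rewrite lt0r c0 andbT; apply: contraTneq leB => ->; rewrite mul0r ler10.
by rewrite ltr_pM2l// ltr_expR ltr_pM2l//; lra.
Qed.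

Lemma vMF_axial nu kappa : 0 < kappa -> axial sigma (vMF sigma nu kappa).
Proof.
move=> k0; split; first exact: vMF_dominated.
  by exists nu; exact: vMF_rotationally_symmetric.
exact: vMF_neq_uniform.
Qed.

End axial_distributions.

Theorem corollary5p3 (R : realType) (n : nat) (hd : (3 <= n.+1)%N)
    (sigma : probability (sphere R n) R) (hsigma : uniform_on_sphere sigma)
    (f : R -> R) (hf : fdiv_generator f)
    (P : probability (sphere R n) R) (hP : axial sigma P)
    (u : sphere R n) (hu : rotationally_symmetric sigma P u)
    (nustar : sphere R n) (kappastar : R)
    (hmin : unique_minimiser
      [set nk : sphere R n * R | 0 < nk.2]
      (fun nk => fdiv f P (vMF sigma nk.1 nk.2))
      (nustar, kappastar)) :
  axis sigma (vMF sigma nustar kappastar) = axis sigma P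
  /\ axis sigma P = <[u : 'rV[R]_n.+1]>%VS.
Proof.
have axPu := axisE sigma hsigma P u hd hP hu.
split; last exact: axPu.
have [[/= k0 nk_min] nk_unique] := hmin.
(* Both axes are now explicit: it remains to see that [nustar] and [u] span the same line. *)
rewrite axPu (axisE sigma hsigma _ nustar)//; last 2 first.
- exact: vMF_axial.
- exact: vMF_rotationally_symmetric.
set O := - householder (sphere_val u).
have sO : sym_involution O by apply/sym_involutionN/householder_involution.
have Psigma : P `<< sigma by case: hP.
have PO : transports (rotate O) P P.
  apply: (rotate_invariant sigma hsigma P u O Psigma hu sO).
  exact: rotate_flip_axis.
have fdivO : fdiv f P (vMF sigma nustar kappastar) =
    fdiv f P (vMF sigma (rotate O nustar) kappastar).
  have mO := measurable_rotate O sO.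
  apply: (fdiv_transports _ mO (rotateK O sO) f P P _ _ PO).
  exact: vMF_rotate.
apply: rotate_flip_fix.
suff : (rotate O nustar, kappastar) = (nustar, kappastar) by case.
apply: nk_unique; split; first exact: k0.
by move=> nk nk0; have := nk_min nk nk0; rewrite [X in (X <= _)%E -> _]fdivO.
Qed.
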